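(* Let $n\ge 0$, let $\mathcal{O}_n$ be the monoid (under composition) of all order-preserving functions $\{0,\ldots,n-1\}\to\{0,\ldots,n-1\}$, and let $\mathcal{B}_n$ be the monoid of endomorphisms of the object $(GF)^n\emptyset$ in the category $\mathcal{B}$ of the free adjunction generated by $(\emptyset,\{\emptyset\})$. Then $\mathcal{B}_n$ is isomorphic to $\mathcal{O}_n$, by an isomorphism under which, for $0\le i\le n-2$, the function $p^i$ corresponds to the arrow $$(GF)^{n-i-2}\gamma^{c}G\varphi^{a}F(GF)^i\mathbf{1}_{\emptyset}:(GF)^n\emptyset\to(GF)^n\emptyset$$ and the function $q^i$ corresponds to the arrow $$(GF)^{n-i-2}G\varphi^{a}F\gamma^{c}(GF)^i\mathbf{1}_{\emptyset}:(GF)^n\emptyset\to(GF)^n\emptyset .$$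
   Context: For $0\le i\le n-2$, $p^i\in\mathcal{O}_n$ is the function with $p^i(i+1)=i$ and $p^i(j)=j$ for $j\ne i+1$; $q^i\in\mathcal{O}_n$ is the function with $q^i(i)=i+1$ and $q^i(j)=j$ for $j\ne i$. Free adjunction generated by $(\emptyset,\{\emptyset\})$. The objects of $\mathcal{B}$ are the words $(GF)^n\emptyset$, $n\ge 0$; the objects of $\mathcal{A}$ are the words $F(GF)^n\emptyset$, $n\ge 0$. Below $a,a_1,\ldots$ denote objects of $\mathcal{A}$ and $b,b_1,\ldots$ objects of $\mathcal{B}$; $Fb$ and $Ga$ denote the words obtained by prefixing. The (arrow) terms, with types, are defined inductively: $\mathbf{1}_a:a\to a$ is a term of $\mathcal{A}$ and $\mathbf{1}_b:b\to b$ a term of $\mathcal{B}$; composable terms $f_1,f_2$ of $\mathcal{A}$ give a term $f_2\circ f_1$ of $\mathcal{A}$, and similarly in $\mathcal{B}$; if $g:b_1\to b_2$ is a term of $\mathcal{B}$, then $Fg:Fb_1\to Fb_2$ is a term of $\mathcal{A}$ and $\gamma^{c}g:b_1\to GFb_2$ is a term of $\mathcal{B}$; if $f:a_1\to a_2$ is a term of $\mathcal{A}$, then $Gf:Ga_1\to Ga_2$ is a term of $\mathcal{B}$ and $\varphi^{a}f:FGa_1\to a_2$ is a term of $\mathcal{A}$. Equality of terms in $\mathcal{A}$ and $\mathcal{B}$ is the smallest congruence satisfying, whenever both sides are defined: the category equations (units and associativity); $F\mathbf{1}_b=\mathbf{1}_{Fb}$, $G\mathbf{1}_a=\mathbf{1}_{Ga}$;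 $Fg_2\circ Fg_1=F(g_2\circ g_1)$, $Gf_2\circ Gf_1=G(f_2\circ f_1)$; $f_2\circ\varphi^{a}f_1=\varphi^{a}(f_2\circ f_1)$, $\gamma^{c}g_2\circ g_1=\gamma^{c}(g_2\circ g_1)$; $\varphi^{a}f_2\circ FGf_1=\varphi^{a}(f_2\circ f_1)$, $GFg_2\circ\gamma^{c}g_1=\gamma^{c}(g_2\circ g_1)$; $\varphi^{a}f\circ F\gamma^{c}g=f\circ Fg$, $G\varphi^{a}f\circ\gamma^{c}g=Gf\circ g$. The arrows of $\mathcal{A}$ and $\mathcal{B}$ are the equivalence classes of terms. *)

(* Defs.v *)
From HB Require Import structures.
From mathcomp Require Import all_boot.
From mathcomp Require Import boolp.

Set Implicit Arguments.
Unset Strict Implicit.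
Unset Printing Implicit Defensive.

Local Open Scope group_scope.
Local Open Scope quotient_scope.

Definition order_preserving n : pred {ffun 'I_n -> 'I_n} :=
  fun f => [forall i : 'I_n, forall j : 'I_n, (i <= j)%N ==> (f i <= f j)%N].

Record On (n : nat) := OnMk {
  On_val :> {ffun 'I_n -> 'I_n};
  On_valP : order_preserving On_val
}.

HB.instance Definition _ n := [isSub for @On_val n].
HB.instance Definition _ n := [Finite of On n by <:].

Lemma order_preservingP n (f : {ffun 'I_n -> 'I_n}) :
  reflect {homo f : i j / (i <= j)%N} (order_preserving f).
Proof.
by apply: (iffP forallP) => [H i j|H i];
  [move: (H i) => /forallP/(_ j)/implyP | apply/forallP => j; apply/implyP/H].
Qed.

Lemma On_comp_subproof n (f g : On n) :
  order_preserving [ffun i => f (g i)].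
Proof.
apply/order_preservingP => i j le_ij; rewrite !ffunE.
exact/(order_preservingP _ (On_valP f))/(order_preservingP _ (On_valP g)).
Qed.

Lemma On_id_subproof n : order_preserving [ffun i : 'I_n => i].
Proof. by apply/order_preservingP => i j le_ij; rewrite !ffunE. Qed.

(* [On_comp f g] is f after g. *)
Definition On_comp n (f g : On n) : On n := OnMk (On_comp_subproof f g).
Definition On_id n : On n := OnMk (On_id_subproof n).

Lemma On_compA n : associative (@On_comp n).
Proof. by move=> f g h; apply/val_inj/ffunP => i; rewrite !ffunE. Qed.

Lemma On_comp1f n : left_id (On_id n) (@On_comp n).
Proof. by move=> f; apply/val_inj/ffunP => i; rewrite !ffunE. Qed.

Lemma On_compf1 n : right_id (On_id n) (@On_comp n).
Proof. by move=> f; apply/val_inj/ffunP => i; rewrite !ffunE. Qed.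

HB.instance Definition _ n :=
  isMonoid.Build (On n) (@On_compA n) (@On_comp1f n) (@On_compf1 n).

Section GeneratorsOn.
Variables (n i : nat) (Hi : (i.+1 < n)%N).

Definition p_fun : {ffun 'I_n -> 'I_n} :=
  [ffun j : 'I_n => if j == i.+1 :> nat then Ordinal (ltnW Hi) else j].

Definition q_fun : {ffun 'I_n -> 'I_n} :=
  [ffun j : 'I_n => if j == i :> nat then Ordinal Hi else j].

Lemma p_fun_subproof : order_preserving p_fun.
Proof.
apply/order_preservingP => j k le_jk; rewrite !ffunE.
case: eqP => [jE|jN]; case: eqP => [kE|kN] //=.
- by apply: leq_trans le_jk; rewrite jE.
- by rewrite -ltnS -kE ltn_neqAle le_jk andbT; apply/eqP; rewrite kE.
Qed.

Lemma q_fun_subproof : order_preserving q_fun.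
Proof.
apply/order_preservingP => j k le_jk; rewrite !ffunE.
case: eqP => [jE|jN]; case: eqP => [kE|kN] //=.
- by rewrite ltn_neqAle -{2}jE le_jk andbT; apply/eqP => /esym.
- by apply: leq_trans le_jk _; rewrite kE.
Qed.

Definition p_On : On n := OnMk p_fun_subproof.
Definition q_On : On n := OnMk q_fun_subproof.
End GeneratorsOn.

(* Free adjunction with F : B -> A left adjoint to G : A -> B, generated by no
   object of A and the single object [emptyO] of B.  Since F and G alternate,
   [objA] consists of the words F(GF)^n emptyO and [objB] of the words
   (GF)^n emptyO. *)
Inductive objA : Type :=
| F_o of objB
with objB : Type :=
| emptyO
| G_o of objA.

(* In [compA f2 f1] and [compB g2 g1] the second argument is applied first. *)
Inductive termA : objA -> objA -> Type :=
| idA a : termA a a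
| compA a1 a2 a3 : termA a2 a3 -> termA a1 a2 -> termA a1 a3
| F_t b1 b2 : termB b1 b2 -> termA (F_o b1) (F_o b2)
| phi a1 a2 : termA a1 a2 -> termA (F_o (G_o a1)) a2
with termB : objB -> objB -> Type :=
| idB b : termB b b
| compB b1 b2 b3 : termB b2 b3 -> termB b1 b2 -> termB b1 b3
| G_t a1 a2 : termA a1 a2 -> termB (G_o a1) (G_o a2)
| gamma b1 b2 : termB b1 b2 -> termB b1 (G_o (F_o b2)).

(* The smallest congruence on typed terms containing the equations of an
   adjunction; only terms of equal type are compared. *)
Inductive eqA : forall a1 a2, termA a1 a2 -> termA a1 a2 -> Prop :=
| eqA_refl a1 a2 (f : termA a1 a2) : eqA f f
| eqA_sym a1 a2 (f g : termA a1 a2) : eqA f g -> eqA g f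
| eqA_trans a1 a2 (f g h : termA a1 a2) : eqA f g -> eqA g h -> eqA f h
| eqA_comp a1 a2 a3 (f f' : termA a2 a3) (g g' : termA a1 a2) :
    eqA f f' -> eqA g g' -> eqA (compA f g) (compA f' g')
| eqA_F b1 b2 (g g' : termB b1 b2) : eqB g g' -> eqA (F_t g) (F_t g')
| eqA_phi a1 a2 (f f' : termA a1 a2) : eqA f f' -> eqA (phi f) (phi f')
| eqA_comp1f a1 a2 (f : termA a1 a2) : eqA (compA (idA a2) f) f
| eqA_compf1 a1 a2 (f : termA a1 a2) : eqA (compA f (idA a1)) f
| eqA_compA a1 a2 a3 a4
    (f3 : termA a3 a4) (f2 : termA a2 a3) (f1 : termA a1 a2) :
    eqA (compA f3 (compA f2 f1)) (compA (compA f3 f2) f1)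
| eqA_F1 b : eqA (F_t (idB b)) (idA (F_o b))
| eqA_Fcomp b1 b2 b3 (g2 : termB b2 b3) (g1 : termB b1 b2) :
    eqA (compA (F_t g2) (F_t g1)) (F_t (compB g2 g1))
| eqA_comp_phi a1 a2 a3 (f2 : termA a2 a3) (f1 : termA a1 a2) :
    eqA (compA f2 (phi f1)) (phi (compA f2 f1))
| eqA_phi_FG a1 a2 a3 (f2 : termA a2 a3) (f1 : termA a1 a2) :
    eqA (compA (phi f2) (F_t (G_t f1))) (phi (compA f2 f1))
| eqA_phi_Fgamma b1 b2 a (f : termA (F_o b2) a) (g : termB b1 b2) :
    eqA (compA (phi f) (F_t (gamma g))) (compA f (F_t g))
with eqB : forall b1 b2, termB b1 b2 -> termB b1 b2 -> Prop :=
| eqB_refl b1 b2 (g : termB b1 b2) : eqB g g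
| eqB_sym b1 b2 (g h : termB b1 b2) : eqB g h -> eqB h g
| eqB_trans b1 b2 (g h k : termB b1 b2) : eqB g h -> eqB h k -> eqB g k
| eqB_comp b1 b2 b3 (g g' : termB b2 b3) (h h' : termB b1 b2) :
    eqB g g' -> eqB h h' -> eqB (compB g h) (compB g' h')
| eqB_G a1 a2 (f f' : termA a1 a2) : eqA f f' -> eqB (G_t f) (G_t f')
| eqB_gamma b1 b2 (g g' : termB b1 b2) : eqB g g' -> eqB (gamma g) (gamma g')
| eqB_comp1f b1 b2 (g : termB b1 b2) : eqB (compB (idB b2) g) g
| eqB_compf1 b1 b2 (g : termB b1 b2) : eqB (compB g (idB b1)) g
| eqB_compA b1 b2 b3 b4
    (g3 : termB b3 b4) (g2 : termB b2 b3) (g1 : termB b1 b2) :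
    eqB (compB g3 (compB g2 g1)) (compB (compB g3 g2) g1)
| eqB_G1 a : eqB (G_t (idA a)) (idB (G_o a))
| eqB_Gcomp a1 a2 a3 (f2 : termA a2 a3) (f1 : termA a1 a2) :
    eqB (compB (G_t f2) (G_t f1)) (G_t (compA f2 f1))
| eqB_gamma_comp b1 b2 b3 (g2 : termB b2 b3) (g1 : termB b1 b2) :
    eqB (compB (gamma g2) g1) (gamma (compB g2 g1))
| eqB_GF_gamma b1 b2 b3 (g2 : termB b2 b3) (g1 : termB b1 b2) :
    eqB (compB (G_t (F_t g2)) (gamma g1)) (gamma (compB g2 g1))
| eqB_Gphi_gamma b a1 a2 (f : termA a1 a2) (g : termB b (G_o a1)) :
    eqB (compB (G_t (phi f)) (gamma g)) (compB (G_t f) g).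

(* Arbitrary (classical) choice structure on terms, needed only to form the
   quotient below. *)
HB.instance Definition _ b1 b2 := gen_eqMixin (termB b1 b2).
HB.instance Definition _ b1 b2 := gen_choiceMixin (termB b1 b2).

Definition eqBb b1 b2 : rel (termB b1 b2) := fun g h => `[< eqB g h >].

Section EqBEquiv.
Variables b1 b2 : objB.

Lemma eqBb_refl : reflexive (@eqBb b1 b2).
Proof. by move=> g; apply/asboolP/eqB_refl. Qed.

Lemma eqBb_sym : symmetric (@eqBb b1 b2).
Proof. by move=> g h; apply/asboolP/asboolP; apply: eqB_sym. Qed.

Lemma eqBb_trans : transitive (@eqBb b1 b2).
Proof.
by move=> g h k /asboolP e1 /asboolP e2; apply/asboolP; apply: eqB_trans e1 e2.
Qed.

Definition eqBb_equiv := EquivRel (@eqBb b1 b2) eqBb_refl eqBb_sym eqBb_trans.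
Canonical eqBb_equiv.

(* An arrow of the category B is an equivalence class of terms. *)
Definition homB : Type := {eq_quot eqBb_equiv}.
HB.instance Definition _ := Choice.on homB.
HB.instance Definition _ := EqQuotient.on homB.

Definition arrowB (g : termB b1 b2) : homB := \pi_homB g.

Lemma arrowBP (g h : termB b1 b2) : arrowB g = arrowB h <-> eqB g h.
Proof.
by split=> [/eqmodP/asboolP // | e]; apply/eqmodP/asboolP.
Qed.

Lemma arrowBK (x : homB) : arrowB (repr x) = x.
Proof. exact: reprK. Qed.

Lemma eqB_repr (g : termB b1 b2) : eqB (repr (arrowB g)) g.
Proof. by apply/arrowBP; rewrite arrowBK. Qed.
End EqBEquiv.

Definition homB_comp b1 b2 b3 (x : homB b2 b3) (y : homB b1 b2) : homB b1 b3 :=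
  arrowB (compB (repr x) (repr y)).

Lemma homB_compE b1 b2 b3 (g : termB b2 b3) (h : termB b1 b2) :
  homB_comp (arrowB g) (arrowB h) = arrowB (compB g h).
Proof. by apply/arrowBP/eqB_comp; apply: eqB_repr. Qed.

Lemma homB_compA b1 b2 b3 b4
    (z : homB b3 b4) (y : homB b2 b3) (x : homB b1 b2) :
  homB_comp z (homB_comp y x) = homB_comp (homB_comp z y) x.
Proof.
rewrite -(arrowBK x) -(arrowBK y) -(arrowBK z) !homB_compE.
exact/arrowBP/eqB_compA.
Qed.

Lemma homB_comp1f b1 b2 (x : homB b1 b2) : homB_comp (arrowB (idB b2)) x = x.
Proof.
by rewrite -(arrowBK x) homB_compE; apply/arrowBP/eqB_comp1f.
Qed.

Lemma homB_compf1 b1 b2 (x : homB b1 b2) : homB_comp x (arrowB (idB b1)) = x.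
Proof.
by rewrite -(arrowBK x) homB_compE; apply/arrowBP/eqB_compf1.
Qed.

Definition GF_o (n : nat) (b : objB) : objB :=
  iter n (fun b' => G_o (F_o b')) b.

Fixpoint GF_t (n : nat) b1 b2 (g : termB b1 b2) :
    termB (GF_o n b1) (GF_o n b2) :=
  if n is m.+1 then G_t (F_t (GF_t m g)) else g.

Definition Bn (n : nat) : Type := homB (GF_o n emptyO) (GF_o n emptyO).

HB.instance Definition _ n := Choice.on (Bn n).
HB.instance Definition _ n := isMonoid.Build (Bn n)
  (@homB_compA _ _ _ _) (@homB_comp1f _ _) (@homB_compf1 _ _).

(* [GF_o (n - i - 2) (GF_o i.+2 emptyO)] and [GF_o n emptyO] are equal but not
   convertible, hence the transport; [objB] having decidable equality, the
   choice of the proof of equality is irrelevant. *)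
Definition cast_endB b b' (e : b = b') (g : termB b b) : termB b' b' :=
  ecast c (termB c c) e g.

Section GeneratorsBn.
Variables (n i : nat) (Hi : (i.+1 < n)%N).

Lemma GF_oE : GF_o (n - i - 2) (GF_o i.+2 emptyO) = GF_o n emptyO.
Proof. by rewrite /GF_o -iterD -subnDA addn2 subnK. Qed.

Let GFi1 : termB (GF_o i emptyO) (GF_o i emptyO) := GF_t i (idB emptyO).

(* (GF)^(n-i-2) gamma G phi F (GF)^i 1 *)
Definition p_term : termB (GF_o n emptyO) (GF_o n emptyO) :=
  cast_endB GF_oE (GF_t (n - i - 2) (gamma (G_t (phi (F_t GFi1))))).

(* (GF)^(n-i-2) G phi F gamma (GF)^i 1 *)
Definition q_term : termB (GF_o n emptyO) (GF_o n emptyO) :=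
  cast_endB GF_oE (GF_t (n - i - 2) (G_t (phi (F_t (gamma GFi1))))).

Definition p_Bn : Bn n := arrowB p_term.
Definition q_Bn : Bn n := arrowB q_term.
End GeneratorsBn.

(* Main.v *)
From HB Require Import structures.
Require Import Defs.
From mathcomp Require Import all_boot zify.
From mathcomp Require Import boolp.

(** The free adjunction has a concrete model.  Read the word [(GF)^n emptyO] as
    the ordinal [{0, ..., n-1}] and [F (GF)^n emptyO] as [{0, ..., n}] with its
    greatest element distinguished.  Arrows of B are the monotone maps, arrows of
    A the monotone maps that preserve the greatest element; [F] adds a new
    greatest element and [G] forgets that it is distinguished.  The theorem says
    that this model is full and faithful on B.

    To make evaluation of terms strictly functorial, a map between finite
    ordinals [n] and [m] is continued to all of [nat] by [n + k |-> m + k].  Then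
    [F] and [G] do not change the underlying function, [phi f] is [f] after the
    degeneracy [unbump], [gamma g] is the coface [bump] after [g], and the
    equations of the adjunction become pointwise identities on [nat], the
    triangle equations being the simplicial ones ([bumpK], [unbump_bumpS]);
    this is [ev_sound].

    For faithfulness, the equations, read from left to right, eliminate
    composition ([cut_elim_size]), so every term equals a normal one, built from
    the identity of [emptyO] by [F], [G], [phi] and [gamma] ([normalize]).  The
    last constructor of a normal term can be read off its value: [gamma g] is
    the case where the greatest element is not attained, and [phi f] the case
    where it is attained at a second, undistinguished point.  Hence distinct
    normal terms have distinct values ([normal_inj], [ev_faithful]).  The same
    dichotomies, used to peel a given monotone map, show that every monotone map
    is a value ([ev_full]).  The isomorphism sends a monotone function to the
    class of any term with that value, and the images of [p^i] and [q^i] are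
    found by evaluating the two given terms. *)

Set Implicit Arguments.
Unset Strict Implicit.
Unset Printing Implicit Defensive.

Scheme termA_mut := Induction for termA Sort Prop
with termB_mut := Induction for termB Sort Prop.
Combined Scheme term_mutind from termA_mut, termB_mut.

Scheme eqA_mut := Minimality for eqA Sort Prop
with eqB_mut := Minimality for eqB Sort Prop.
Combined Scheme eq_mutind from eqA_mut, eqB_mut.

(** * Monotone maps with a translation tail *)

(** The underlying functions of arrows of A: [n] and [m] are the distinguished
    greatest elements of the two ordinals, [k = 0] says that they correspond, and
    [k > 0] fixes the continuation to [nat]. *)
Definition tail_map n m (f : nat -> nat) :=
  {homo f : x y / x <= y} /\ forall k, f (n + k) = m + k.

(** The underlying functions of arrows of B, monotone maps from
    [{0, ..., n-1}] to [{0, ..., m-1}] with their continuation to [nat]. *)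
Definition ord_map n m (f : nat -> nat) :=
  tail_map n m f /\ forall x, x < n -> f x < m.

Lemma tail_map_le n m f x : tail_map n m f -> x <= n -> f x <= m.
Proof. by case=> mono tl /mono le_x; rewrite -(addn0 m) -tl addn0. Qed.

Lemma tail_map_ge n m f x : tail_map n m f -> n <= x -> f x = m + (x - n).
Proof. by case=> _ tl le_nx; rewrite -tl subnKC. Qed.

(** Naturality of the unit: the coface that skips the greatest element commutes
    with maps. *)
Lemma ord_map_bump n m f x :
  ord_map n m f -> f (bump n x) = bump m (f x).
Proof.
case=> ft flt; rewrite /bump; case: (leqP n x) => [nx|/flt xn].
  by rewrite !(tail_map_ge ft) ?leq_addr; lia.
by rewrite leqNgt xn.
Qed.

(** Naturality of the counit: the degeneracy that merges the two greatest
    elements commutes with maps that preserve the greatest one. *)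
Lemma tail_map_unbump n m f x :
  tail_map n m f -> f (unbump n x) = unbump m (f x).
Proof.
move=> ft; rewrite /unbump; case: (ltnP n x) => [nx|/(tail_map_le ft) xn].
  by rewrite !(tail_map_ge ft); lia.
by rewrite ltnNge xn /= !subn0.
Qed.

(** A degeneracy also cancels the coface one step above it; together with
    [bumpK] this gives the two triangle equations. *)
Lemma unbump_bumpS n x : unbump n (bump n.+1 x) = x.
Proof. by rewrite /unbump /bump; lia. Qed.

Lemma unbump_surj n (f g : nat -> nat) :
  f \o unbump n =1 g \o unbump n -> f =1 g.
Proof. by move=> e x; rewrite -(bumpK n x); apply: e. Qed.

Lemma tail_map_comp n m p f g :
  tail_map n m f -> tail_map m p g -> tail_map n p (g \o f).
Proof.
move=> [fm ft] [gm gt]; split=> [x y /fm/gm //|k /=].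
by rewrite ft gt.
Qed.

Lemma ord_map_comp n m p f g :
  ord_map n m f -> ord_map m p g -> ord_map n p (g \o f).
Proof.
move=> [ft flt] [gt glt]; split; first exact: tail_map_comp ft gt.
by move=> x /flt/glt.
Qed.

Lemma tail_map_phi n m f : tail_map n m f -> tail_map n.+1 m (f \o unbump n).
Proof.
move=> [fm ft]; split=> [x y xy|k] /=; first by apply: fm; rewrite /unbump; lia.
by rewrite -ft /unbump; congr f; lia.
Qed.

Lemma ord_map_gamma n m f : ord_map n m f -> ord_map n m.+1 (bump m \o f).
Proof.
move=> [[fm ft] flt]; split; first split.
- by move=> x y /fm xy /=; rewrite leq_bump2.
- by move=> k /=; rewrite ft /bump; lia.
- by move=> x /flt xm /=; rewrite /bump; lia.
Qed.

(** The passage along [G]: monotonicity bounds a map on the whole of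
    [{0, ..., n}] by the image of the greatest element. *)
Lemma ord_map_top n m f : tail_map n m f -> ord_map n.+1 m.+1 f.
Proof.
move=> ft; split; first split; first by case: ft.
- by move=> k; rewrite (tail_map_ge ft); lia.
- by move=> x; rewrite !ltnS; apply: tail_map_le.
Qed.

(** * Evaluation of terms *)

(** The height of a word of B is the size of its ordinal; that of a word of A is
    the greatest element of its ordinal, one less than the size. *)
Fixpoint heightA (a : objA) : nat := let: F_o b := a in heightB b
with heightB (b : objB) : nat := if b is G_o a then (heightA a).+1 else 0.

Fixpoint evA a1 a2 (f : termA a1 a2) : nat -> nat :=
  match f with
  | idA _ => id
  | Defs.compA _ _ _ f2 f1 => evA f2 \o evA f1
  | F_t _ _ g => evB g
  | phi a _ f => evA f \o unbump (heightA a)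
  end
with evB b1 b2 (g : termB b1 b2) : nat -> nat :=
  match g with
  | idB _ => id
  | compB _ _ _ g2 g1 => evB g2 \o evB g1
  | G_t _ _ f => evA f
  | gamma _ b g => bump (heightB b) \o evB g
  end.

Lemma ev_map :
  (forall a1 a2 (f : termA a1 a2), tail_map (heightA a1) (heightA a2) (evA f)) /\
  (forall b1 b2 (g : termB b1 b2), ord_map (heightB b1) (heightB b2) (evB g)).
Proof.
apply: term_mutind => /=.
- by split=> [x y|k].
- by move=> a1 a2 a3 f2 h2 f1 h1; apply: tail_map_comp h1 h2.
- by move=> b1 b2 g [].
- by move=> a1 a2 f; apply: tail_map_phi.
- by split=> //; split=> [x y|k].
- by move=> b1 b2 b3 g2 h2 g1 h1; apply: ord_map_comp h1 h2.
- by move=> a1 a2 f; apply: ord_map_top.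
- by move=> b1 b2 g; apply: ord_map_gamma.
Qed.

Lemma ev_sound :
  (forall a1 a2 (f f' : termA a1 a2), eqA f f' -> evA f =1 evA f') /\
  (forall b1 b2 (g g' : termB b1 b2), eqB g g' -> evB g =1 evB g').
Proof.
apply: eq_mutind => //=.
- by move=> a1 a2 f g _ e x; rewrite e.
- by move=> a1 a2 f g h _ e1 _ e2 x; rewrite e1.
- by move=> a1 a2 a3 f f' g g' _ e1 _ e2 x /=; rewrite e2 e1.
- by move=> a1 a2 f f' _ e x /=; rewrite e.
- move=> a1 a2 a3 f2 f1 x /=.
  by rewrite -(tail_map_unbump _ (ev_map.1 _ _ f1)).
- by move=> b1 b2 a f g x /=; rewrite bumpK.
- by move=> b1 b2 f g _ e x; rewrite e.
- by move=> b1 b2 f g h _ e1 _ e2 x; rewrite e1.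
- by move=> a1 a2 a3 f f' g g' _ e1 _ e2 x /=; rewrite e2 e1.
- by move=> a1 a2 f f' _ e x /=; rewrite e.
- by move=> b1 b2 b3 g2 g1 x /=; rewrite (ord_map_bump _ (ev_map.2 _ _ g2)).
- by move=> b a1 a2 f g x /=; rewrite unbump_bumpS.
Qed.

(** * Cut elimination *)

(** Normal terms are the cut-free terms in which the only identity is that of
    [emptyO]. *)
Fixpoint normalA a1 a2 (f : termA a1 a2) : Prop :=
  match f with
  | idA _ | Defs.compA _ _ _ _ _ => False
  | F_t _ _ g => normalB g
  | phi _ _ f => normalA f
  end
with normalB b1 b2 (g : termB b1 b2) : Prop :=
  match g with
  | idB b => if b is emptyO then True else False
  | compB _ _ _ _ _ => False
  | G_t _ _ f => normalA f
  | gamma _ _ g => normalB g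
  end.

Fixpoint sizeA a1 a2 (f : termA a1 a2) : nat :=
  match f with
  | idA _ => 1
  | Defs.compA _ _ _ f2 f1 => (sizeA f2 + sizeA f1).+1
  | F_t _ _ g => (sizeB g).+1
  | phi _ _ f => (sizeA f).+1
  end
with sizeB b1 b2 (g : termB b1 b2) : nat :=
  match g with
  | idB b => 1
  | compB _ _ _ g2 g1 => (sizeB g2 + sizeB g1).+1
  | G_t _ _ f => (sizeA f).+1
  | gamma _ _ g => (sizeB g).+1
  end.

(** Every object of A has the form [F_o b], so this covers all normal terms of
    A.  The returned predicates depend on the source because [phi] only exists
    when it is in the image of [G_o]. *)
Lemma normalA_inv b1 b2 (f : termA (F_o b1) (F_o b2)) : normalA f ->
  (exists2 g, normalB g & f = F_t g) \/
  match b1 return termA (F_o b1) (F_o b2) -> Prop with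
  | G_o a => fun f => exists2 f', normalA f' & f = phi f'
  | emptyO => fun=> False
  end f.
Proof.
(* Generalizing the two indices lets [h] be destructed. *)
pose P a1 a2 : termA a1 a2 -> Prop :=
  match a1, a2 with F_o b1, F_o b2 => fun f =>
  (exists2 g, normalB g & f = F_t g) \/
  match b1 return termA (F_o b1) (F_o b2) -> Prop with
  | G_o a => fun f => exists2 f', normalA f' & f = phi f'
  | emptyO => fun=> False
  end f end.
suff H a1 a2 (h : termA a1 a2) : normalA h -> P _ _ h by apply: H.
case: a1 a2 / h => //= [c1 c2 g ng | a [c] h nh]; first by left; exists g.
by right; exists h.
Qed.

Lemma normalB_inv b1 b2 (g : termB b1 b2) : normalB g ->
  match b2 return termB b1 b2 -> Prop with
  | emptyO => match b1 return termB b1 emptyO -> Prop with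
              | emptyO => fun g => g = idB emptyO
              | G_o _ => fun=> False
              end
  | G_o (F_o b) => fun g =>
    (exists2 g', normalB g' & g = gamma g') \/
    match b1 return termB b1 (G_o (F_o b)) -> Prop with
    | emptyO => fun=> False
    | G_o a => fun g => exists2 f, normalA f & g = G_t f
    end g
  end g.
Proof.
case: b1 b2 / g => //= [[]// | a [b] f nf | b1 b2 g ng].
  by right; exists f.
by left; exists g.
Qed.

(** In each case one of the defining equations moves the composition to terms of
    smaller total size, or, at the identity, removes it.  Plain structural
    induction does not suffice: the triangle equations recombine a premise of
    one factor with a term rebuilt from the other. *)
Lemma cut_elim_size k :
  (forall a1 a2 a3 (f2 : termA a2 a3) (f1 : termA a1 a2),
     normalA f2 -> normalA f1 -> sizeA f2 + sizeA f1 < k ->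
     exists2 f, normalA f & eqA (Defs.compA f2 f1) f) /\
  (forall b1 b2 b3 (g2 : termB b2 b3) (g1 : termB b1 b2),
     normalB g2 -> normalB g1 -> sizeB g2 + sizeB g1 < k ->
     exists2 g, normalB g & eqB (compB g2 g1) g).
Proof.
elim: k => [|k [IHA IHB]]; first by split.
split.
- move=> [b1] [b2] [b3] f2 f1 n2 n1 lt.
  case: (normalA_inv n1) => [[g1 {}n1 e1]|].
  + rewrite {}e1 /= in lt *.
    case: (normalA_inv n2) => [[g2 {}n2 e2]|].
      rewrite {}e2 /= in lt *.
      have [|g ng eg] := IHB _ _ _ g2 g1 n2 n1; first by lia.
      by exists (F_t g) => //; apply: eqA_trans (eqA_Fcomp _ _) (eqA_F eg).
    case: b2 f1 f2 n2 g1 n1 lt => [//|[b2]] _ f2 _ g1 n1 lt [f2' n2 e2].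
    rewrite {}e2 /= in lt *.
    case: (normalB_inv n1) => [[g1' {}n1 e1]|].
      rewrite {}e1 /= in lt *.
      have [||f nf ef] := IHA _ _ _ f2' (F_t g1') n2; rewrite //=; first by lia.
      by exists f => //; apply: eqA_trans (eqA_phi_Fgamma _ _) ef.
    case: b1 g1 n1 lt => [//|a1] g1 _ lt [f1' n1 e1].
    rewrite {}e1 /= in lt *.
    have [|f nf ef] := IHA _ _ _ f2' f1' n2 n1; first by lia.
    by exists (phi f) => //; apply: eqA_trans (eqA_phi_FG _ _) (eqA_phi ef).
  + case: b1 f1 n1 lt => [//|a1] f1 _ lt [f1' n1 e1].
    rewrite {}e1 /= in lt *.
    have [|f nf ef] := IHA _ _ _ f2 f1' n2 n1; first by lia.
    by exists (phi f) => //; apply: eqA_trans (eqA_comp_phi _ _) (eqA_phi ef).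
- move=> b1 b2 [|[b3]] g2 g1 n2 n1 lt.
    case: b2 g2 n2 g1 n1 lt => [|a2] g2 /normalB_inv //= -> g1 n1 _.
    by exists g1 => //; apply: eqB_comp1f.
  case: (normalB_inv n2) => [[g2' {}n2 e2]|].
    rewrite {}e2 /= in lt *.
    have [|g ng eg] := IHB _ _ _ g2' g1 n2 n1; first by lia.
    by exists (gamma g) => //; apply: eqB_trans (eqB_gamma_comp _ _) (eqB_gamma eg).
  case: b2 g2 n2 g1 n1 lt => [//|[b2]] g2 _ g1 n1 lt [f2 n2 e2].
  rewrite {}e2 /= in lt *.
  case: (normalB_inv n1) => [[g1' {}n1 e1]|]; last first.
    case: b1 g1 n1 lt => [//|a1] g1 _ lt [f1 n1 e1].
    rewrite {}e1 /= in lt *.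
    have [|f nf ef] := IHA _ _ _ f2 f1 n2 n1; first by lia.
    by exists (G_t f) => //; apply: eqB_trans (eqB_Gcomp _ _) (eqB_G ef).
  rewrite {}e1 /= in lt *.
  case: (normalA_inv n2) => [[g2' {}n2 e2]|].
    rewrite {}e2 /= in lt *.
    have [|g ng eg] := IHB _ _ _ g2' g1' n2 n1; first by lia.
    by exists (gamma g) => //; apply: eqB_trans (eqB_GF_gamma _ _) (eqB_gamma eg).
  case: b2 g1 g2 f2 n2 g1' n1 lt => [//|a2] _ _ f2 _ g1 n1 lt [f2' n2 e2].
  rewrite {}e2 /= in lt *.
  have [|g ng eg] := IHB _ _ _ (G_t f2') g1 n2 n1; rewrite /=; first by lia.
  by exists g => //; apply: eqB_trans (eqB_Gphi_gamma _ _) eg.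
Qed.

Lemma normalize_idB b : exists2 g, normalB g & eqB (idB b) g.
Proof.
move: b; fix IH 1; case=> [|[b]]; first by exists (idB emptyO) => //; apply: eqB_refl.
have [g ng eg] := IH b; exists (G_t (F_t g)) => //.
apply: eqB_trans (eqB_sym (eqB_G1 _)) (eqB_G _).
exact: eqA_trans (eqA_sym (eqA_F1 _)) (eqA_F eg).
Qed.

Lemma normalize_idA a : exists2 f, normalA f & eqA (idA a) f.
Proof.
case: a => b; have [g ng eg] := normalize_idB b; exists (F_t g) => //.
exact: eqA_trans (eqA_sym (eqA_F1 b)) (eqA_F eg).
Qed.

Lemma normalize :
  (forall a1 a2 (f : termA a1 a2), exists2 f', normalA f' & eqA f f') /\
  (forall b1 b2 (g : termB b1 b2), exists2 g', normalB g' & eqB g g').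
Proof.
apply: term_mutind.
- exact: normalize_idA.
- move=> a1 a2 a3 f2 [f2' n2 e2] f1 [f1' n1 e1].
  have [f nf ef] := (cut_elim_size _).1 _ _ _ _ _ n2 n1 (ltnSn _).
  by exists f => //; apply: eqA_trans (eqA_comp e2 e1) ef.
- by move=> b1 b2 g [g' ng eg]; exists (F_t g') => //; apply: eqA_F.
- by move=> a1 a2 f [f' nf ef]; exists (phi f') => //; apply: eqA_phi.
- exact: normalize_idB.
- move=> b1 b2 b3 g2 [g2' n2 e2] g1 [g1' n1 e1].
  have [g ng eg] := (cut_elim_size _).2 _ _ _ _ _ n2 n1 (ltnSn _).
  by exists g => //; apply: eqB_trans (eqB_comp e2 e1) eg.
- by move=> a1 a2 f [f' nf ef]; exists (G_t f') => //; apply: eqB_G.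
- by move=> b1 b2 g [g' ng eg]; exists (gamma g') => //; apply: eqB_gamma.
Qed.

(** * Faithfulness and fullness of evaluation *)

(** At the greatest element of [G_o a] the first map stays below the
    distinguished element [heightB b], and the second attains it. *)
Lemma F_phi_disjoint a b (g : termB (G_o a) b) (f : termA a (F_o b)) :
  ~ evA (F_t g) =1 evA (phi f).
Proof.
move=> /(_ (heightA a)) /=; rewrite /unbump ltnn subn0.
have [_ /(_ _ (ltnSn _)) lt] := ev_map.2 _ _ g.
rewrite -[X in evA f X]addn0 (ev_map.1 _ _ f).2 /= addn0 => e.
by rewrite e ltnn in lt.
Qed.

(** The first map skips the value [heightB b], which the second takes at the
    greatest element. *)
Lemma gamma_G_disjoint a b (g : termB (G_o a) b) (f : termA a (F_o b)) :
  ~ evB (gamma g) =1 evB (G_t f).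
Proof.
move=> /(_ (heightA a)) /=.
rewrite -[X in evA f X]addn0 (ev_map.1 _ _ f).2 /= addn0 => /esym/eqP.
by apply/negP/neq_bump.
Qed.

Lemma normal_inj :
  (forall a1 a2 (f f' : termA a1 a2),
     normalA f -> normalA f' -> evA f =1 evA f' -> f = f') /\
  (forall b1 b2 (g g' : termB b1 b2),
     normalB g -> normalB g' -> evB g =1 evB g' -> g = g').
Proof.
apply: term_mutind => //=.
- move=> b1 b2 g IH f' ng /normalA_inv [[g' ng' ->]|]; first by move=> /(IH _ ng ng')->.
  case: b1 g {IH} ng f' => [//|a] g _ f' [f nf ->] e.
  by case: (@F_phi_disjoint _ _ g f).
- move=> a [b] f IH f' nf /normalA_inv [[g' ng' ->] e|[f'' nf'' ->]].
    by case: (@F_phi_disjoint _ _ g' f) => x; apply/esym/e.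
  by move=> /unbump_surj /(IH _ nf nf'') ->.
- by case=> // g' _ /normalB_inv.
- move=> a [b] f IH g' nf /normalB_inv [[g'' ng'' ->] e|[f'' nf'' ->]].
    by case: (@gamma_G_disjoint _ _ g'' f) => x; apply/esym/e.
  by move=> /(IH _ nf nf'') ->.
- move=> b1 b2 g IH g' ng /normalB_inv [[g'' ng'' ->] e|].
    by congr gamma; apply: IH => // x; apply: (can_inj (bumpK _)) (e x).
  case: b1 g {IH} ng g' => [//|a] g _ g' [f nf ->] e.
  by case: (@gamma_G_disjoint _ _ g f).
Qed.

(** Coherence: equality of arrows is decided by their underlying functions. *)
Lemma ev_faithful b1 b2 (g g' : termB b1 b2) : evB g =1 evB g' <-> eqB g g'.
Proof.
split=> [e|]; last exact: ev_sound.2.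
have [[h nh eh] [h' nh' eh']] := (normalize.2 _ _ g, normalize.2 _ _ g').
suff eqh : h = h' by rewrite eqh in eh; apply: eqB_trans eh (eqB_sym eh').
apply: normal_inj.2 => // x.
by rewrite -(ev_sound.2 _ _ _ _ eh) -(ev_sound.2 _ _ _ _ eh').
Qed.

(** A map preserving the greatest element either sends nothing else to it, and
    then comes from B by [F], or it also sends the preceding point there, and
    then factors through the degeneracy, so that [phi] applies.  Fullness on B
    and on the smaller source are hypotheses, to be supplied by the induction in
    [ev_full]. *)
Lemma full_F b1 b2 :
  (forall f, ord_map (heightB b1) (heightB b2) f ->
     exists g : termB b1 b2, evB g =1 f) ->
  (forall a f, b1 = G_o a -> tail_map (heightA a) (heightB b2) f ->
     exists h : termA a (F_o b2), evA h =1 f) ->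
  forall f, tail_map (heightB b1) (heightB b2) f ->
    exists h : termA (F_o b1) (F_o b2), evA h =1 f.
Proof.
move=> fullB fullA f ft.
have [flt|/existsNP[x /not_implyP[xn fx]]] :=
  pselect (forall x, x < heightB b1 -> f x < heightB b2).
  by have [g eg] := fullB f (conj ft flt); exists (F_t g).
case: b1 {fullB} fullA ft xn => [|a] fullA ft //= xn.
have fn : f (heightA a) = heightB b2.
  apply/eqP; rewrite eqn_leq (tail_map_le ft) //=.
  by apply: leq_trans (ft.1 x _ _); [rewrite leqNgt; apply/negP | rewrite -ltnS].
have ft' : tail_map (heightA a) (heightB b2) (f \o bump (heightA a)).
  split=> [y z yz|k] /=; first by apply: ft.1; rewrite leq_bump2.
  by rewrite -ft.2 /bump leq_addr.
have [h eh] := fullA a _ erefl ft'; exists (phi h) => y /=; rewrite eh /=.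
case: (eqVneq y (heightA a)) => [->|ya]; last by rewrite unbumpK.
(* At the merged point both sides are the greatest element: it is also the
   value one step further, where the tail begins. *)
rewrite fn /unbump ltnn subn0 /bump leqnn -(addn0 (heightB b2)) -ft.2 /=.
by congr f; lia.
Qed.

(** Either the greatest element of the target is attained, by the greatest
    element of the source, and [G] applies; or the map factors through the
    coface skipping it, and [gamma] applies. *)
Lemma ev_full b1 b2 f : ord_map (heightB b1) (heightB b2) f ->
  exists g : termB b1 b2, evB g =1 f.
Proof.
have [k] := ubnP (heightB b1 + heightB b2).
elim: k b1 b2 f => // k IH b1 b2 f lek [ft flt].
have fullA c1 c2 h : heightB c1 + heightB c2 < k ->
    tail_map (heightB c1) (heightB c2) h ->
    exists f' : termA (F_o c1) (F_o c2), evA f' =1 h.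
  (* [phi] shortens the source but keeps the target, hence the inner induction. *)
  have [j] := ubnP (heightB c1); elim: j c1 h => // j IHj c1 h lej lec.
  apply: full_F => [h' |[c1'] h' e1]; first exact: IH.
  by rewrite {}e1 /= in lej lec *; apply: IHj; lia.
case: b2 lek ft flt => [|[b2]] /= lek ft flt.
  case: b1 lek ft flt => [|a] /= _ ft flt; last by have := flt 0 isT.
  by exists (idB emptyO) => x; rewrite -[X in f X]add0n ft.2.
have [fm|/existsNP[x /not_implyP[fx _]]] :=
  pselect (forall x, f x = heightB b2 -> False); last first.
  case: b1 lek ft flt => [|[b1]] /= lek ft flt.
    by have := ft.2 x; rewrite !add0n fx; lia.
  have fb : f (heightB b1) = heightB b2.
    have xb : x <= heightB b1.
      by rewrite leqNgt; apply/negP => /(tail_map_ge ft); rewrite fx; lia.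
    apply/eqP; rewrite eqn_leq -ltnS flt //= -fx; exact: ft.1.
  have ft' : tail_map (heightB b1) (heightB b2) f.
    split=> [|[|k']]; first exact: ft.1; first by rewrite !addn0.
    by rewrite addnS -addSn ft.2; lia.
  by have [|h eh] := fullA _ _ _ _ ft'; [lia | exists (G_t h)].
have [||g eg] := IH b1 b2 (unbump (heightB b2) \o f); first by lia.
- split; first split.
  - by move=> x y /ft.1 xy /=; rewrite /unbump; lia.
  - by move=> j /=; rewrite ft.2 /unbump; lia.
  - by move=> x /flt xm /=; have := fm x; rewrite /unbump; lia.
exists (gamma g) => x /=; rewrite eg /= unbumpK //.
by apply/eqP => /fm.
Qed.

(** * The isomorphism *)

Lemma heightB_GF n : heightB (GF_o n emptyO) = n.
Proof. by elim: n => //= n ->. Qed.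

Definition realizes n (f : On n) (g : termB (GF_o n emptyO) (GF_o n emptyO)) :=
  forall i : 'I_n, evB g i = f i.

Lemma ev_endo n (g : termB (GF_o n emptyO) (GF_o n emptyO)) :
  ord_map n n (evB g).
Proof. by have := ev_map.2 _ _ g; rewrite heightB_GF. Qed.

Lemma realizes_eqB n (f : On n) g g' :
  realizes f g -> realizes f g' -> eqB g g'.
Proof.
move=> rg rg'; apply/ev_faithful => x; case: (ltnP x n) => [xn|nx].
  by rewrite (rg (Ordinal xn)) (rg' (Ordinal xn)).
by rewrite !(tail_map_ge (ev_endo _).1).
Qed.

Lemma realizes_exists n (f : On n) : exists g, realizes f g.
Proof.
pose h x := if insub x is Some i then f i : nat else x.
have hE (i : 'I_n) : h i = f i by rewrite /h valK.
have hn x : n <= x -> h x = x by move=> nx; rewrite /h insubF // ltnNge nx.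
have hlt x : x < n -> h x < n by move=> xn; rewrite (hE (Ordinal xn)).
have [|g eg] := @ev_full (GF_o n emptyO) (GF_o n emptyO) h; last first.
  by exists g => i; rewrite eg.
rewrite heightB_GF; split=> //; split=> [x y xy|k]; last by rewrite hn ?leq_addr.
case: (ltnP y n) => [yn|ny].
  have xn := leq_ltn_trans xy yn.
  rewrite (hE (Ordinal xn)) (hE (Ordinal yn)).
  exact: (order_preservingP _ (On_valP f)).
rewrite (hn y) //; case: (ltnP x n) => [/hlt xn|/hn -> //].
by apply: leq_trans (ltnW xn) ny.
Qed.

Lemma realized_exists n (g : termB (GF_o n emptyO) (GF_o n emptyO)) :
  exists f : On n, realizes f g.
Proof.
have [[gm _] glt] := ev_endo g.
pose f := [ffun i : 'I_n => Ordinal (glt i (ltn_ord i))].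
have fP : order_preserving f.
  by apply/order_preservingP => i j ij; rewrite !ffunE; apply: gm.
by exists (OnMk fP) => i; rewrite ffunE.
Qed.

(** By [realizes_eqB] the choice of the realizing term does not matter;
    [arrow_ofE] is the form in which this is used. *)
Definition arrow_of n (f : On n) : Bn n :=
  arrowB (projT1 (cid (realizes_exists f))).

Lemma arrow_ofE n (f : On n) g : realizes f g -> arrow_of f = arrowB g.
Proof.
move=> rg; apply/arrowBP; apply: realizes_eqB rg.
exact: projT2 (cid (realizes_exists f)).
Qed.

Lemma arrow_of_realizes n (f : On n) g : arrow_of f = arrowB g -> realizes f g.
Proof.
move=> /arrowBP /ev_faithful e i.
by rewrite -e; apply: (projT2 (cid (realizes_exists f)) i).
Qed.

Lemma arrow_of_monoid_morphism n : monoid_morphism (@arrow_of n).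
Proof.
split=> [|f g]; first by apply: arrow_ofE => i; rewrite ffunE.
have [[s rs] [t rt]] := (realizes_exists f, realizes_exists g).
rewrite (arrow_ofE rs) (arrow_ofE rt).
transitivity (arrowB (compB s t)); last by rewrite -homB_compE.
by apply: arrow_ofE => i; rewrite /= rt rs ffunE.
Qed.

HB.instance Definition _ n :=
  isUMagmaMorphism.Build (On n) (Bn n) (@arrow_of n) (arrow_of_monoid_morphism n).

Lemma arrow_of_bij n : bijective (@arrow_of n).
Proof.
have sur (x : Bn n) : exists f, arrow_of f = x.
  have [f rf] := realized_exists (repr x).
  by exists f; rewrite (arrow_ofE rf) arrowBK.
exists (fun x => projT1 (cid (sur x))) => [f|x]; last exact: projT2 (cid (sur x)).
case: cid => f' /= e; have [g rg] := realizes_exists f.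
have rg' : realizes f' g by apply: arrow_of_realizes; rewrite e; apply: arrow_ofE.
by apply/val_inj/ffunP => i; apply/val_inj; rewrite /= -rg -rg'.
Qed.

Lemma evB_cast b b' (e : b = b') (g : termB b b) : evB (cast_endB e g) = evB g.
Proof. by case: b' / e. Qed.

Lemma evB_GF_t k b1 b2 (g : termB b1 b2) : evB (GF_t k g) = evB g.
Proof. by elim: k. Qed.

Lemma p_term_realizes n i (Hi : i.+1 < n) : realizes (p_On Hi) (p_term Hi).
Proof.
move=> j; rewrite evB_cast evB_GF_t /= !evB_GF_t /= heightB_GF ffunE.
by rewrite /bump /unbump; case: eqP => /=; lia.
Qed.

Lemma q_term_realizes n i (Hi : i.+1 < n) : realizes (q_On Hi) (q_term Hi).
Proof.
move=> j; rewrite evB_cast evB_GF_t /= !evB_GF_t /= heightB_GF ffunE.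
by rewrite /bump /unbump; case: eqP => /=; lia.
Qed.

Theorem mainTheorem13 (n : nat) :
  exists h : UMagmaMorphism.type (On n) (Bn n),
    bijective h /\
    forall (i : nat) (Hi : (i.+1 < n)%N),
      h (p_On Hi) = p_Bn Hi /\ h (q_On Hi) = q_Bn Hi.
Proof.
exists (@arrow_of n : UMagmaMorphism.type (On n) (Bn n)).
split=> [|i Hi]; first exact: arrow_of_bij.
by split; apply: arrow_ofE; [apply: p_term_realizes | apply: q_term_realizes].
Qed.
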